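(* For every $d\in\{4,\dots,16\}$ there exists a set $\mathcal{X}\subset\mathbb{R}^d$ of unit vectors spanning $|\mathcal{X}|=\binom{d}{3}$ biangular lines. Moreover, there exists a set $\mathcal{X}\subset\mathbb{R}^{17}$ of unit vectors spanning $|\mathcal{X}|=\binom{18}{3}$ biangular lines.
   Context: For a finite set $\mathcal{X}\subset\mathbb{R}^d$ of unit vectors put $A(\mathcal{X}):=\{\langle x,x'\rangle\colon x\neq x';\ x,x'\in\mathcal{X}\}$. The set $\mathcal{X}$ spans a system of biangular lines (the lines through the origin in the directions $x\in\mathcal{X}$) if $-1\notin A(\mathcal{X})$ and $|\{\gamma^2\colon\gamma\in A(\mathcal{X})\}|\leq 2$. *)

(* Defs.v *)
From mathcomp Require Import all_boot all_order all_algebra.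
From mathcomp Require Import finmap reals.
Set Implicit Arguments.
Unset Strict Implicit.
Unset Printing Implicit Defensive.
Import Order.TTheory GRing.Theory Num.Theory.
Local Open Scope fset_scope.
Local Open Scope ring_scope.

Section BiangularLines.
Variables (R : realType) (d : nat).
Implicit Types (x y : 'rV[R]_d) (X : {fset 'rV[R]_d}).

Definition dotv x y : R := \sum_(i < d) x 0 i * y 0 i.

Definition enorm x : R := Num.sqrt (dotv x x).

Definition unit_vectors X : Prop := forall x, x \in X -> enorm x = 1.

Definition inner_products X : {fset R} :=
  [fset dotv x y | x in X, y in X & x != y].

(* For unit vectors, -1 not being an inner product says that distinct elements
   of X span distinct lines, so the number of lines is #|` X|. *)
Definition spans_biangular_lines X : Prop :=
  -1 \notin inner_products X /\
  (#|` [fset g ^+ 2 | g in inner_products X]| <= 2)%N.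

End BiangularLines.

(* Main.v *)
(** Suppose [f_1, ..., f_n] have Gram matrix [I - J/18]. For a triple [T] the
    vector [sum_(i in T) f_i] has squared norm [3 - 9/18 = 5/2], and two
    distinct triples give the inner product [#|T :&: T'| - 1/2], that is
    [-1/2], [1/2] or [3/2]: only two values up to sign. The vectors
    [e_i + a (1, ..., 1)] of [R^d] have this Gram matrix when
    [d a^2 + 2 a = -1/18], which is solvable for [d <= 18]. The matrix [I - J/18]
    of order 18 is singular, so the case [n = 18] already fits in [R^17]: adjoin
    to the 17 vectors above a suitable multiple of [(1, ..., 1)]. *)
Require Import Defs.
From mathcomp Require Import all_boot all_order all_algebra.
From mathcomp Require Import finmap reals.
From mathcomp Require Import ring lra.
Import Order.TTheory GRing.Theory Num.Theory.
Local Open Scope fset_scope.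
Local Open Scope ring_scope.

Set Implicit Arguments.
Unset Strict Implicit.

Section Dot.
Context {R : realType} {d : nat}.
Implicit Types x y : 'rV[R]_d.

Lemma dotvE x y : dotv x y = (x *m y^T) 0 0.
Proof. by rewrite mxE; apply: eq_bigr => i _; rewrite mxE. Qed.

Lemma dotvC x y : dotv x y = dotv y x.
Proof. by apply: eq_bigr => i _; rewrite mulrC. Qed.

Lemma dotvDl x1 x2 y : dotv (x1 + x2) y = dotv x1 y + dotv x2 y.
Proof. by rewrite !dotvE mulmxDl mxE. Qed.

Lemma dotvDr x y1 y2 : dotv x (y1 + y2) = dotv x y1 + dotv x y2.
Proof. by rewrite ![dotv x _]dotvC dotvDl. Qed.

Lemma dotvZl k x y : dotv (k *: x) y = k * dotv x y.
Proof. by rewrite !dotvE -scalemxAl mxE. Qed.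

Lemma dotvZr k x y : dotv x (k *: y) = k * dotv x y.
Proof. by rewrite ![dotv x _]dotvC dotvZl. Qed.

Lemma dotv_suml (I : finType) (A : {set I}) (f : I -> 'rV[R]_d) y :
  dotv (\sum_(i in A) f i) y = \sum_(i in A) dotv (f i) y.
Proof.
by rewrite dotvE mulmx_suml summxE; apply: eq_bigr => i _; rewrite dotvE.
Qed.

Lemma dotv_sumr (I : finType) (A : {set I}) (f : I -> 'rV[R]_d) x :
  dotv x (\sum_(i in A) f i) = \sum_(i in A) dotv x (f i).
Proof. by rewrite dotvC dotv_suml; apply: eq_bigr => i _; rewrite dotvC. Qed.

Lemma dotv_delta i x : dotv (delta_mx 0 i) x = x 0 i.
Proof.
rewrite /dotv (bigD1 i) //= mxE !eqxx mul1r big1 ?addr0 // => j ji.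
by rewrite mxE (negbTE ji) andbF mul0r.
Qed.

Lemma dotv_const (a b : R) :
  dotv (const_mx a : 'rV_d) (const_mx b) = a * b *+ d.
Proof.
rewrite /dotv; under eq_bigr do rewrite !mxE.
by rewrite sumr_const card_ord.
Qed.

Lemma dotv_delta_const (a b : R) (i j : 'I_d) :
  dotv (delta_mx 0 i + const_mx a) (delta_mx 0 j + const_mx b) =
  (i == j)%:R + (a + b + a * b *+ d).
Proof.
rewrite dotvDl !dotvDr dotv_const !dotv_delta [dotv (const_mx a) _]dotvC.
by rewrite dotv_delta !mxE !eqxx /= addrA -!addrA [b + (a + _)]addrCA.
Qed.

(** By bilinearity the [c] part contributes once per pair in [A] times [B], while for fixed [i] in
    [A] the Kronecker terms over [B] add up to 1 or 0 according to whether [i] lies in [B]. *)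
Lemma dotv_sums (I : finType) (f : I -> 'rV[R]_d) c (A B : {set I}) :
    (forall i j, dotv (f i) (f j) = (i == j)%:R - c) ->
  dotv (\sum_(i in A) f i) (\sum_(i in B) f i) =
  #|A :&: B|%:R - c * (#|A| * #|B|)%:R.
Proof.
move=> fE; rewrite dotv_suml.
under eq_bigr => i _.
  rewrite dotv_sumr; under eq_bigr do rewrite fE.
  rewrite sumrB sumr_const.
  over.
rewrite sumrB sumr_const -mulrnA mulr_natr mulnC; congr (_ - _).
rewrite -sum1_card natr_sum.
under [RHS]eq_bigl do rewrite in_setI.
rewrite big_mkcondr; apply: eq_bigr => i _.
case: ifP => iB.
  rewrite (bigD1 i) //= eqxx big1 ?addr0 // => j /andP[_ ji].
  by rewrite eq_sym (negbTE ji).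
by rewrite big1 // => j jB; case: eqP => // ij; rewrite ij jB in iB.
Qed.

End Dot.

Section Triples.
Context {R : realType} {d n : nat} (f : 'I_n -> 'rV[R]_d).
Hypothesis fE : forall i j, dotv (f i) (f j) = (i == j)%:R - 18^-1.

(** The factor turns the squared norm 5/2 of a triple sum into 1. *)
Let v (T : {set 'I_n}) := Num.sqrt (2 / 5) *: \sum_(i in T) f i.

Let dot_v (A B : {set 'I_n}) : #|A| = 3%N -> #|B| = 3%N ->
  dotv (v A) (v B) = (2 * #|A :&: B|%:R - 1) / 5.
Proof.
move=> A3 B3; rewrite dotvZl dotvZr mulrA -expr2 sqr_sqrtr; last by lra.
by rewrite (dotv_sums _ _ fE) A3 B3 /=; field.
Qed.

Let cardI_lt3 (A B : {set 'I_n}) :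
  #|A| = 3%N -> #|B| = 3%N -> A != B -> (#|A :&: B| < 3)%N.
Proof.
move=> A3 B3; apply: contraNltn => I3.
have /eqP AI : A :&: B == A by rewrite eqEcard subsetIl A3.
by rewrite eqEcard -{1}AI subsetIr A3 B3.
Qed.

(** Keeping [n] and [d] independent lets this serve both [n = d] and [n = 18], [d = 17]. *)
Lemma biangular_triples : exists X : {fset 'rV[R]_d},
  [/\ unit_vectors X, spans_biangular_lines X & #|` X| = 'C(n, 3)].
Proof.
pose X := [fset v T | T in [pred T : {set 'I_n} | #|T| == 3%N]].
(* The possible values are -1/5, 1/5 and 3/5, so -1 is excluded and the squares are 1/25 and
   9/25. *)
have ipP g : g \in inner_products X ->
    exists2 k, (k < 3)%N & g = (2 * k%:R - 1) / 5.
  case/imfset2P => _ /imfsetP[A /eqP A3 ->] [_ /andP[/imfsetP[B /eqP B3 ->] AB] ->].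
  exists #|A :&: B|; last exact: dot_v.
  by apply: cardI_lt3 => //; apply: contraNneq AB => ->.
exists X; split; [|split|].
- move=> _ /imfsetP[T /eqP T3 ->]; rewrite /enorm dot_v // setIid T3.
  by rewrite (_ : _ / _ = 1) ?sqrtr1 //; field.
- by apply/negP => /ipP[[|[|[|//]]] _]; lra.
- have sq2 : [fset g ^+ 2 | g in inner_products X] `<=` [fset 25^-1; 9 / 25 : R].
    apply/fsubsetP => _ /imfsetP[g /= /ipP[k k3 ->] ->]; rewrite !inE.
    by case: k k3 => [|[|[|//]]] _; apply/orP;
      [left|left|right]; apply/eqP; field.
  apply: leq_trans (fsubset_leq_card sq2) _.
  by rewrite cardfs2; case: (_ != _).
(* [v] is injective on triples: the inner product of equal images is 1, which would need a common
   part of size 3. *)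
- rewrite card_in_imfset /=; last first.
    move=> A B /eqP A3 /eqP B3 vAB; apply/eqP; apply: contraT => AB.
    have := dot_v A3 B3; rewrite -vAB dot_v // setIid A3.
    have := cardI_lt3 A3 B3 AB.
    by case: #|_| => [|[|[|//]]] _; lra.
  rewrite -[in RHS](card_ord n) -card_draws cardE; congr size.
  by apply: eq_enum => A; rewrite !inE.
Qed.

End Triples.

Unset Implicit Arguments.

Theorem corollary2p9 (R : realType) :
  (forall d : nat, (4 <= d <= 16)%N ->
     exists X : {fset 'rV[R]_d},
       [/\ unit_vectors X, spans_biangular_lines X & #|` X| = 'C(d, 3)]) /\
  (exists X : {fset 'rV[R]_17},
     [/\ unit_vectors X, spans_biangular_lines X & #|` X| = 'C(18, 3)]).
Proof.
split=> [d /andP[d4 d16]|].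
  have d4R : 4 <= d%:R :> R by rewrite ler_nat.
  have d16R : d%:R <= 16 :> R by rewrite ler_nat.
  (* Multiplied by [d], the equation [d a^2 + 2 a = -1/18] becomes [(d a + 1)^2 = 1 - d/18]; [r] is
     the root [d a + 1]. *)
  pose r : R := Num.sqrt (1 - d%:R / 18).
  have r2 : r ^+ 2 = 1 - d%:R / 18 by rewrite sqr_sqrtr //; lra.
  pose a : R := (r - 1) / d%:R.
  apply: (biangular_triples (f := fun i => delta_mx 0 i + const_mx a)) => i j.
  rewrite dotv_delta_const; congr (_ + _).
  have -> : a + a + a * a *+ d = (r ^+ 2 - 1) / d%:R.
    by rewrite -mulr_natr /a; field; lra.
  by rewrite r2; field; lra.
(* The extra vector needs [17 b^2 = 1 - 1/18], hence [b^2 = 1/18]. *)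
pose b : R := (Num.sqrt 18)^-1.
have b2 : b ^+ 2 = 18^-1 by rewrite exprVn sqr_sqrtr.
(* Here [(17 a + 1)^2 = 1 - 17/18 = b^2]. The root [17 a + 1 = - b] is the one for which the mixed
   inner product [b (17 a + 1)] equals -1/18. *)
pose a : R := (- 1 - b) / 17.
(* [ord_max] indexes the constant vector; the other indices are [lift ord_max k] with [k] among the
   17 coordinates. *)
pose f (i : 'I_18) : 'rV[R]_17 :=
  if unlift ord_max i is Some k then delta_mx 0 k + const_mx a else const_mx b.
have dot_b k : dotv (delta_mx 0 k + const_mx a) (const_mx b : 'rV_17) = - 18^-1.
  by rewrite dotvDl dotv_delta dotv_const mxE -b2 /a; field.
apply: (biangular_triples (f := f)) => i j; rewrite /f.
case: unliftP => [k|] ->; case: unliftP => [l|] ->.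
- rewrite dotv_delta_const (inj_eq lift_inj); congr (_ + _).
  have -> : a + a + a * a *+ 17 = (b ^+ 2 - 1) / 17 by rewrite /a; field.
  by rewrite b2; field.
- by rewrite dot_b eq_sym (negbTE (neq_lift _ _)) sub0r.
- by rewrite dotvC dot_b (negbTE (neq_lift _ _)) sub0r.
- by rewrite dotv_const eqxx -expr2 b2 /=; field.
Qed.
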